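(* Let $n\ge2$, $0\le l<k\le n$, $\theta\in(0,\pi)$, $p>k-l+1$, and let $f$ be a positive smooth function on $\mathcal{C}_\theta$. Then the positive admissible solution of $$\frac{\sigma_k(\nabla^2h+h\sigma)}{\sigma_l(\nabla^2h+h\sigma)}=f\,h^{p-1}\ \text{ in }\mathcal{C}_\theta,\qquad \nabla_\mu h=\cot\theta\, h\ \text{ on }\partial\mathcal{C}_\theta$$ is unique.
   Context: Let $e=-E_{n+1}$, $E_1,\dots,E_{n+1}$ the standard basis of $\mathbb{R}^{n+1}$, $\overline{\mathbb{R}^{n+1}_+}=\{x_{n+1}\ge0\}$. $\mathcal{C}_\theta=\{\xi\in\overline{\mathbb{R}^{n+1}_+}:|\xi-\cos\theta\,e|=1\}$ with round metric $\sigma$, connection $\nabla$, unit outward conormal $\mu$ of $\partial\mathcal{C}_\theta$. $\sigma_j(W)$ is the $j$-th elementary symmetric function of the eigenvalues of $W$ ($\sigma_0=1$); $\Gamma_k=\{\lambda\in\mathbb{R}^n:\sigma_i(\lambda)>0,1\le i\le k\}$; $h\in C^2(\mathcal{C}_\theta)$ is admissible if the eigenvalues of $\nabla^2h+h\sigma$ lie in $\Gamma_k$ everywhere. *)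

(* Defs.v *)
From HB Require Import structures.
From mathcomp Require Import all_boot all_order all_algebra.
From mathcomp Require Import all_classical all_reals all_analysis.
Unset Printing Implicit Defensive.
Import Order.TTheory GRing.Theory Num.Theory.
Import numFieldNormedType.Exports.
Local Open Scope classical_set_scope.
Local Open Scope ring_scope.

(* Points of R^{n+1} are row vectors 'rV[R]_(n.+1); coordinate x_{n+1} is
   the last coordinate (index ord_max). *)

Definition dotv {R : realType} {m : nat} (u v : 'rV[R]_m) : R :=
  \sum_(i < m) u 0 i * v 0 i.
Definition enorm {R : realType} {m : nat} (u : 'rV[R]_m) : R :=
  Num.sqrt (dotv u u).

Definition Elast {R : realType} (n : nat) : 'rV[R]_(n.+1) :=
  \row_(i < n.+1) (if i == ord_max then 1 else 0).
Definition evec {R : realType} (n : nat) : 'rV[R]_(n.+1) := - Elast n.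

Definition ccenter {R : realType} (n : nat) (theta : R) : 'rV[R]_(n.+1) :=
  cos theta *: evec n.

Definition cap {R : realType} (n : nat) (theta : R) : set 'rV[R]_(n.+1) :=
  [set x : 'rV[R]_(n.+1) | 0 <= x 0 ord_max /\ enorm (x - ccenter n theta) = 1].

Definition bcap {R : realType} (n : nat) (theta : R) : set 'rV[R]_(n.+1) :=
  [set x : 'rV[R]_(n.+1) | cap n theta x /\ x 0 ord_max = 0].

(** The 1-homogeneous extension (about the centre) of a function h on the
    sphere |xi - c| = 1:  H(x) = |x - c| h(c + (x - c)/|x - c|).
    For xi on the sphere and tangent X, Y, D^2 H(xi)[X,Y] = (nabla^2 h + h sigma)(X,Y),
    and D H(xi)[X] = nabla_X h. *)
Definition hext {R : realType} (n : nat) (theta : R)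
    (h : 'rV[R]_(n.+1) -> R) (x : 'rV[R]_(n.+1)) : R :=
  let c := ccenter n theta in
  enorm (x - c) * h (c + (enorm (x - c))^-1 *: (x - c)).

Fixpoint iterD {R : realType} {m : nat} (vs : seq 'rV[R]_m)
    (F : 'rV[R]_m -> R) : 'rV[R]_m -> R :=
  match vs with
  | [::] => F
  | v :: vs' => fun x => derive (iterD vs' F) x v
  end.

Definition C2_on {R : realType} {m : nat} (U : set 'rV[R]_m)
    (F : 'rV[R]_m -> R) : Prop :=
  forall (vs : seq 'rV[R]_m) x, U x ->
    ((size vs <= 1)%N -> differentiable (iterD vs F) x) /\
    (size vs = 2%N -> {for x, continuous (iterD vs F)}).

Definition smooth_on {R : realType} {m : nat} (U : set 'rV[R]_m)
    (F : 'rV[R]_m -> R) : Prop :=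
  forall (vs : seq 'rV[R]_m) x, U x -> differentiable (iterD vs F) x.

Definition smooth_cap {R : realType} (n : nat) (theta : R)
    (f : 'rV[R]_(n.+1) -> R) : Prop :=
  exists U, open U /\ cap n theta `<=` U /\ smooth_on U f.

(** h in C^2(C_theta) (up to the boundary): h (a function on the sphere)
    is C^2 on a neighbourhood of the cap, expressed through its
    homogeneous extension. *)
Definition C2_cap {R : realType} (n : nat) (theta : R)
    (h : 'rV[R]_(n.+1) -> R) : Prop :=
  exists U, open U /\ cap n theta `<=` U /\ C2_on U (hext n theta h).

Definition tframe {R : realType} (n : nat) (theta : R)
    (xi : 'rV[R]_(n.+1)) (b : 'M[R]_(n, n.+1)) : Prop :=
  (forall i j, dotv (row i b) (row j b) = (i == j)%:R) /\
  (forall i, dotv (row i b) (xi - ccenter n theta) = 0).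

(** matrix of W = nabla^2 h + h sigma at xi in the frame b *)
Definition Wmat {R : realType} (n : nat) (theta : R)
    (h : 'rV[R]_(n.+1) -> R) (xi : 'rV[R]_(n.+1)) (b : 'M[R]_(n, n.+1))
    : 'M[R]_n :=
  \matrix_(i, j) iterD [:: row i b; row j b] (hext n theta h) xi.

(** sigma_j of the eigenvalues of A: since char_poly A = prod (X - lambda_i)
    = sum_j (-1)^j sigma_j(lambda) X^(n-j). *)
Definition sigmaj {R : realType} {n : nat} (j : nat) (A : 'M[R]_n) : R :=
  (-1) ^+ j * (char_poly A)`_(n - j).

Definition admissible {R : realType} (n k : nat) (theta : R)
    (h : 'rV[R]_(n.+1) -> R) : Prop :=
  forall xi b, cap n theta xi -> tframe n theta xi b ->
    forall i, (1 <= i <= k)%N -> 0 < sigmaj i (Wmat n theta h xi b).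

(** unit outward conormal of the boundary of C_theta at xi in bcap:
    the normalised component of e tangent to the sphere,
    mu = (e + cos theta (xi - c)) / sin theta. *)
Definition conormal {R : realType} (n : nat) (theta : R)
    (xi : 'rV[R]_(n.+1)) : 'rV[R]_(n.+1) :=
  (sin theta)^-1 *: (evec n + cos theta *: (xi - ccenter n theta)).

Definition is_solution {R : realType} (n k l : nat) (theta p : R)
    (f h : 'rV[R]_(n.+1) -> R) : Prop :=
  [/\ C2_cap n theta h,
      (forall xi, cap n theta xi -> 0 < h xi),
      admissible n k theta h,
      (forall xi b, cap n theta xi -> tframe n theta xi b ->
         sigmaj k (Wmat n theta h xi b) / sigmaj l (Wmat n theta h xi b)
         = f xi * h xi `^ (p - 1)) &
      (forall xi, bcap n theta xi ->
         derive (hext n theta h) xi (conormal n theta xi)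
         = cos theta / sin theta * h xi)].

(* Main.v *)
(* At a maximum point x0 of h1 / h2 with value t, the 1-homogeneous extensions
   satisfy t H2 - H1 >= 0 on the cone over the cap, with equality at x0. The Robin
   condition forces the gradient of the difference to vanish even if x0 is a
   boundary point, so W[h1] <= t W[h2] as quadratic forms at x0. As sigma_k / sigma_l
   is monotone on Gamma_k, the equation gives t^(p-1) <= t^(k-l), hence t <= 1.

   Monotonicity of sigma_k / sigma_l: a nonnegative form is a sum of rank one forms
   v^T v, and the roots of the characteristic polynomial
   (1 - i) chi_A + i chi_(A + v^T v) of A + i v^T v lie in the upper half-plane. By
   Gauss-Lucas so do those of its derivatives, and Im (q'/q)(0) >= 0 for such a
   derivative q says that sigma_(j+1) (A + v^T v) / sigma_(j+1) A is at least
   sigma_j (A + v^T v) / sigma_j A. *)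

Require Import Defs.
From HB Require Import structures.
From mathcomp Require Import all_boot all_order all_algebra.
From mathcomp Require Import all_classical all_reals all_analysis.
From mathcomp Require Import complex ring lra zify.
Import Order.TTheory GRing.Theory Num.Theory.
Import numFieldNormedType.Exports.
Local Open Scope classical_set_scope.
Local Open Scope ring_scope.

(** * Monotonicity of sigma_k / sigma_l *)

(** Block elimination. Bordering confines [v] to the top row, so the determinant becomes affine in
    [v]. *)
Lemma det_block1 (K : comNzRingType) n (M : 'M[K]_n) (u : 'cV_n) (v : 'rV_n) :
  \det (block_mx (1%:M : 'M[K]_1) v (- u) M) = \det (M + u *m v).
Proof.
have -> : block_mx (1%:M : 'M[K]_1) v (- u) M =
    block_mx 1%:M 0 (- u) 1%:M *m block_mx 1%:M v 0 (M + u *m v).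
  rewrite mulmx_block !mul0mx !mul1mx mulmx1 !addr0 mulNmx.
  by rewrite [in RHS]addrC addrK.
by rewrite det_mulmx det_lblock det_ublock !det1 !mul1r.
Qed.

(** The bordered matrix of the scaled update has top row [(1, s v) = (1 - s) (1, 0) + s (1, v)], and
    the determinant is linear in that row. *)
Lemma det_rank1 (K : comNzRingType) n (M : 'M[K]_n) (u : 'cV_n) (v : 'rV_n) s :
  \det (M + s *: (u *m v)) = (1 - s) * \det M + s * \det (M + u *m v).
Proof.
have <- : \det (block_mx (1%:M : 'M[K]_1) 0 (- u) M) = \det M.
  by rewrite det_block1 mulmx0 addr0.
rewrite scalemxAr -!det_block1.
apply: (@determinant_multilinear _ _ _ _ _ (lshift n ord0)).
- rewrite /block_mx !rowKu !row_id !scale_row_mx add_row_mx !scaler0 add0r.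
  by rewrite -scalerDl subrK scale1r.
- rewrite /block_mx !row'Ku; apply: (congr1 (fun X : 'M[K]_(0, _) => col_mx X _)).
  by apply/matrixP => -[].
- rewrite /block_mx !row'Ku; apply: (congr1 (fun X : 'M[K]_(0, _) => col_mx X _)).
  by apply/matrixP => -[].
Qed.

(** Used below with [s = 'i], where it separates the real and imaginary parts of the
    coefficients. *)
Lemma char_poly_rank1 (K : comNzRingType) n (A : 'M[K]_n) (u : 'cV_n) (v : 'rV_n) s :
  char_poly (A + s *: (u *m v)) =
  (1 - s) *: char_poly A + s *: char_poly (A + u *m v).
Proof.
have E t : char_poly (A + t *: (u *m v)) =
    \det (char_poly_mx A + t%:P *: (map_mx polyC (- u) *m map_mx polyC v)).
  rewrite /char_poly /char_poly_mx map_mxN mulNmx scalerN -map_mxM -map_mxZ.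
  by rewrite map_mxD opprD addrA.
have := E 1; rewrite scale1r => ->; rewrite E det_rank1 scale1r -!mul_polyC.
by rewrite polyCB.
Qed.

(** * Polynomials with all roots in the closed upper half-plane *)

Section UpperHalfPlane.
Variable R : rcfType.
Local Notation C := R[i].

Lemma Im_inv_ge0 (z : C) : complex.Im z <= 0 -> 0 <= complex.Im z^-1.
Proof.
case: z => a b /= b0; rewrite -mulNr divr_ge0 ?oppr_ge0//.
by rewrite addr_ge0 ?sqr_ge0.
Qed.

Lemma Im_inv_gt0 (z : C) : complex.Im z < 0 -> 0 < complex.Im z^-1.
Proof.
case: z => a b /= b0; rewrite -mulNr divr_gt0 ?oppr_gt0//.
by rewrite ltr_wpDl ?sqr_ge0// exprn_even_gt0//= lt_eqF.
Qed.

Lemma ImD (x y : C) : complex.Im (x + y) = complex.Im x + complex.Im y.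
Proof. by case: x y => ? ? [? ?]. Qed.

Definition roots_upper (p : {poly C}) :=
  p != 0 /\ forall z, root p z -> 0 <= complex.Im z.

(* [p' / p] is a sum of terms [1 / (z - a)], all of which point upwards when [z]
   lies below the roots. *)
Lemma logderiv_prod (s : seq C) (z : C) :
  let q := \prod_(a <- s) ('X - a%:P) in
  ~~ root q z -> (forall a, a \in s -> complex.Im z <= complex.Im a) ->
  0 <= complex.Im (q^`().[z] / q.[z]) /\
  ((exists2 a, a \in s & complex.Im z < complex.Im a) ->
   0 < complex.Im (q^`().[z] / q.[z])).
Proof.
elim: s => [|a s IH] /=.
  by move=> _ _; rewrite big_nil derivC horner0 mul0r; split => // -[].
rewrite big_cons /root hornerM mulf_eq0 negb_or => /andP[].
rewrite hornerXsubC => za qz sz.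
have [||IH1 IH2] := IH; first exact: qz.
  by move=> b bs; apply: sz; rewrite inE bs orbT.
rewrite derivM derivXsubC mul1r hornerD hornerM hornerXsubC.
set q := \prod_(_ <- _) _ in qz IH1 IH2 *.
have -> : (q.[z] + (z - a) * q^`().[z]) / ((z - a) * q.[z]) =
    (z - a)^-1 + q^`().[z] / q.[z].
  by field; rewrite qz za.
have iza : complex.Im (z - a) = complex.Im z - complex.Im a.
  by case: (z) (a) => ? ? [? ?].
rewrite ImD; split.
  by rewrite addr_ge0// Im_inv_ge0// iza subr_le0 sz// mem_head.
move=> [b]; rewrite inE => /predU1P[->|bs] zb.
  by rewrite ltr_wpDr// Im_inv_gt0// iza subr_lt0.
apply: ltr_wpDl; last by apply: IH2; exists b.
by rewrite Im_inv_ge0// iza subr_le0 sz// mem_head.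
Qed.

(** Split [p] into linear factors; the leading coefficient cancels in [p' / p]. The strict bound
    needs a root to exist, hence the condition on the size. *)
Lemma logderiv_horner (p : {poly C}) (z : C) :
  p.[z] != 0 -> (forall a, root p a -> complex.Im z <= complex.Im a) ->
  0 <= complex.Im (p^`().[z] / p.[z]) /\
  ((1 < size p)%N -> (forall a, root p a -> complex.Im z < complex.Im a) ->
   0 < complex.Im (p^`().[z] / p.[z])).
Proof.
have [s ps] := closed_field_poly_normal p.
have [p0|p0] := eqVneq p 0; first by rewrite p0 horner0 eqxx.
have l0 : lead_coef p != 0 by rewrite lead_coef_eq0.
have rs a : a \in s -> root p a.
  by move=> sa; rewrite ps rootZ// root_prod_XsubC.
move=> pz H.
have E : p^`().[z] / p.[z] = let q := \prod_(a <- s) ('X - a%:P) in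
    q^`().[z] / q.[z].
  rewrite [in LHS]ps derivZ !hornerZ -mulf_div divff// mul1r//.
have qz : ~~ root (\prod_(a <- s) ('X - a%:P)) z.
  by move: pz; rewrite ps hornerZ mulf_eq0 negb_or => /andP[].
have [a sa|H1 H2] := logderiv_prod s z qz; first exact/H/rs.
rewrite E; split => // sp Ha; apply: H2.
case: s ps rs {E qz H1} => [ps rs|a s _ rs].
  by move: sp; rewrite ps big_nil alg_polyC size_polyC l0.
by exists a; [exact: mem_head | apply/Ha/rs/mem_head].
Qed.

(** In characteristic zero the leading coefficient survives differentiation. *)
Lemma size_deriv_num (K : numDomainType) (p : {poly K}) :
  size p^`() = (size p).-1.
Proof.
have [p1|p1] := leqP (size p) 1.
  by rewrite (size1_polyC p1) derivC size_poly0 size_polyC; case: (_ != 0).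
have p0 : p != 0 by rewrite -size_poly_gt0 (ltn_trans _ p1).
apply/eqP; rewrite eqn_leq -ltnS prednK ?size_poly_gt0// lt_size_deriv//=.
move: p0; rewrite -lead_coef_eq0 /lead_coef.
case: (size p) p1 => [|[|k]]//= _ pk; rewrite ltnNge; apply/negP.
move=> /leq_sizeP/(_ _ (leqnn _))/eqP.
by rewrite coef_deriv mulrn_eq0/= (negPf pk).
Qed.

(** Gauss-Lucas for a half-plane: below the real axis [p' / p] has positive imaginary part, so [p']
    cannot vanish there. *)
Lemma roots_upper_deriv (p : {poly C}) :
  (1 < size p)%N -> roots_upper p -> roots_upper p^`().
Proof.
move=> sp [p0 H]; split.
  rewrite -size_poly_eq0 size_deriv_num.
  by case: (size p) sp => [|[]].
move=> z z0; rewrite leNgt; apply/negP => zl0.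
have pz : p.[z] != 0 by apply/negP => /H; rewrite leNgt zl0.
have [a /H /(lt_le_trans zl0)/ltW//|_ H2] := logderiv_horner p z pz.
have : 0 < complex.Im (p^`().[z] / p.[z]).
  by apply: H2 => // a /H; exact: lt_le_trans.
by move/rootP: z0 => ->; rewrite mul0r ltxx.
Qed.

Lemma size_derivn (p : {poly C}) m : size p^`(m) = (size p - m)%N.
Proof.
elim: m => [|m IH]; first by rewrite derivn0 subn0.
by rewrite derivnS size_deriv_num IH -subnS.
Qed.

(** For the [m]-th derivative [q] of [p], the values [q(0)] and [q'(0)] are [m!] and [(m+1)!] times
    the coefficients [m] and [m+1] of [p]. The claim is the sign of the imaginary part of [q' / q]
    at 0. *)
Lemma roots_upper_coef (p : {poly C}) m : (m.+1 < size p)%N -> roots_upper p ->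
  0 <= complex.Im (p`_m.+1 * (p`_m)^*%C).
Proof.
move=> mp Hp.
have {Hp} : roots_upper p^`(m).
  elim: m mp => [//|m IH mp]; rewrite derivnS; apply: roots_upper_deriv.
    by rewrite size_derivn; lia.
  by apply: IH; lia.
set q := p^`(m) => -[q0 Hq].
have q00 : q.[0] = p`_m *+ m`!.
  by rewrite horner_coef0 coef_derivn addn0 ffactnn.
have q10 : q^`().[0] = p`_m.+1 *+ m.+1`!.
  by rewrite horner_coef0 -derivnS coef_derivn addn0 ffactnn.
have [->|pm0] := eqVneq (p`_m) 0; first by rewrite conjc0 mulr0.
have fact0 k : (k`!%:R != 0 :> C) by rewrite pnatr_eq0 -lt0n fact_gt0.
have qz : q.[0] != 0 by rewrite q00 -mulr_natr mulf_neq0.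
(* The point 0 is on the edge of the half-plane, so only the weak inequality is available. *)
have [//|+ _] := logderiv_horner q 0 qz.
rewrite q00 q10 -[_ *+ _]mulr_natr -[X in _ / X]mulr_natr factS natrM.
rewrite [_ * (_ * _)]mulrA -mulf_div divff// mulr1.
case: (p`_m) (p`_m.+1) pm0 => a b [c d]; rewrite eq_complex/= => ab.
rewrite -(rmorph_nat (real_complex R)) /=.
have n0 : 0 < a ^+ 2 + b ^+ 2.
  rewrite lt0r addr_ge0 ?sqr_ge0// andbT paddr_eq0 ?sqr_ge0//.
  by rewrite !expf_eq0.
have -> : (c * m.+1%:R - d * 0) * - (b / (a ^+ 2 + b ^+ 2)) +
    (c * 0 + d * m.+1%:R) * (a / (a ^+ 2 + b ^+ 2)) =
    (c * - b + d * a) * (m.+1%:R / (a ^+ 2 + b ^+ 2)).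
  by field; rewrite gt_eqF.
by rewrite pmulr_lge0// divr_gt0// ltr0n.
Qed.

(** A left eigenvector [u] for [z] satisfies [z |u|^2 = u A u^* + i |u v^T|^2]. The first term on
    the right is real because [A] is real symmetric, so the imaginary part of [z] is a quotient of
    squares. *)
Lemma Im_root_char_poly n (A : 'M[R]_n) (v : 'rV[R]_n) (z : C) : A^T = A ->
  root (char_poly (map_mx (real_complex R) A +
    'i%C *: (map_mx (real_complex R) v^T *m map_mx (real_complex R) v))) z ->
  0 <= complex.Im z.
Proof.
move=> symA; rewrite -eigenvalue_root_char => /eigenvalueP[u].
set Ac := map_mx _ A; set vc := map_mx _ v; set vt := map_mx _ v^T => ez u0.
pose w : 'cV[C]_n := (map_mx conjc u)^T.
have wv : (vc *m w) 0 0 = ((u *m vt) 0 0)^*%C.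
  rewrite !mxE rmorph_sum; apply: eq_bigr => i _.
  by rewrite !mxE rmorphM mulrC; congr (_ * _); exact/esym/conjc_real.
have tr : complex.Im ((u *m Ac *m w) 0 0) = 0.
  have : (u *m Ac *m w) 0 0 = ((u *m Ac *m w) 0 0)^*%C.
    transitivity ((u *m Ac *m w)^T 0 0); first by rewrite [RHS]mxE.
    transitivity ((map_mx conjc (u *m Ac *m w)) 0 0); last by rewrite [LHS]mxE.
    have AcT : Ac^T = Ac by rewrite /Ac map_trmx symA.
    have AcC : map_mx conjc Ac = Ac.
      by apply/matrixP => i j; rewrite !mxE; exact: conjc_real.
    have wC : map_mx conjc w = u^T.
      by apply/matrixP => i j; rewrite !mxE; exact: conjcK.
    by rewrite !trmx_mul trmxK AcT !map_mxM AcC wC mulmxA.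
  by case: (_ 0 0) => a b [] /eqP; rewrite -addr_eq0 -mulr2n mulrn_eq0/= => /eqP.
have us : 0 < (u *m w) 0 0.
  rewrite mxE lt0r; apply/andP; split; last first.
    by apply: sumr_ge0 => i _; rewrite !mxE mulcJ_ge0.
  rewrite psumr_eq0; last by move=> i _; rewrite !mxE mulcJ_ge0.
  apply: contra u0 => /allP H; apply/eqP/rowP => i.
  have := H i (mem_index_enum _); rewrite !mxE mulf_eq0 conjc_eq0 orbb.
  by move/eqP.
have : (z * (u *m w) 0 0) = (u *m Ac *m w) 0 0 +
    'i%C * ((u *m vt) 0 0 * ((u *m vt) 0 0)^*%C).
  have /(congr1 (fun X => (X *m w) 0 0)) := ez.
  rewrite -scalemxAl [RHS]mxE => <-.
  rewrite mulmxDr mulmxDl mxE; congr (_ + _).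
  rewrite -scalemxAr -scalemxAl mxE; congr (_ * _).
  by rewrite mulmxA -(mulmxA (u *m vt)) [LHS]mxE big_ord1 wv.
have := mulcJ_ge0 ((u *m vt) 0 0).
move: tr us; case: (_ 0 0) => t1 t2 /= ->.
case: (_ 0 0) => s1 s2; case: (_ * _^*%C) => q1 q2; case: z {ez} => z1 z2.
rewrite ltcE lecE /= => /andP[/eqP-> s0] /andP[/eqP-> q0] [_].
rewrite !(mul0r, mulr0, mul1r, add0r, addr0) => H.
by rewrite -(pmulr_lge0 _ s0) H.
Qed.

(** With [a] and [b] the coefficients of the two characteristic polynomials, [p] has coefficients
    [a_j + i (b_j - a_j)], and the imaginary part of [p_(m+1)] times the conjugate of [p_m] is
    [b_(m+1) a_m - a_(m+1) b_m]. *)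
Lemma char_poly_coef_rank1 n (A : 'M[R]_n) (v : 'rV[R]_n) m : A^T = A ->
  (m < n)%N ->
  (char_poly A)`_m.+1 * (char_poly (A + v^T *m v))`_m <=
  (char_poly (A + v^T *m v))`_m.+1 * (char_poly A)`_m.
Proof.
move=> symA mn; set B := A + _.
pose p := char_poly (map_mx (real_complex R) A +
    'i%C *: (map_mx (real_complex R) v^T *m map_mx (real_complex R) v)).
have : 0 <= complex.Im (p`_m.+1 * (p`_m)^*%C).
  apply: roots_upper_coef; first by rewrite size_char_poly ltnS.
  split; first by rewrite monic_neq0// char_poly_monic.
  by move=> z; exact: Im_root_char_poly.
have pE j : p`_j = Complex (char_poly A)`_j ((char_poly B)`_j - (char_poly A)`_j).
  rewrite /p char_poly_rank1 -map_mxM -map_mxD -!map_char_poly.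
  rewrite coefD !coefZ !coef_map /=; apply/eqP; rewrite eq_complex /=.
  by apply/andP; split; apply/eqP; ring.
rewrite !pE/=; lra.
Qed.

End UpperHalfPlane.

(** * From coefficients to quotients of the [sigmaj] *)

(** The hypotheses compare consecutive quotients; their product telescopes. Positivity of [b] climbs
    from [b 0] through the same inequalities. *)
Lemma ratio_chain (R : realFieldType) (a b : nat -> R) k :
  (forall i, (i <= k)%N -> 0 < a i) -> 0 < b 0%N ->
  (forall j, (j < k)%N -> b j * a j.+1 <= a j * b j.+1) ->
  (forall i, (i <= k)%N -> 0 < b i) /\
  (forall l, (l <= k)%N -> a k / a l <= b k / b l).
Proof.
move=> a0 b0; elim: k a0 => [|k IH] a0 H.
  split=> [[]//|[|//] _].
  by rewrite !divff ?gt_eqF// a0.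
have [i ik|j jk|b1 b2] := IH; [by apply/a0/leqW | by apply/H/leqW|].
have bk1 : 0 < b k.+1.
  have := H k (leqnn _); rewrite -(pmulr_rgt0 _ (a0 k _))//; apply: lt_le_trans.
  by rewrite mulr_gt0 ?a0 ?b1.
split=> [i|l]; rewrite leq_eqVlt ltnS => /predU1P[->//|ik].
- exact: b1.
- by rewrite !divff ?gt_eqF ?a0.
have := b2 _ ik; have := H k (leqnn _).
have ak := a0 k (leqnSn _); have ak1 := a0 k.+1 (leqnn _).
have al := a0 l (leqW ik); have bl := b1 l ik; have bk := b1 k (leqnn _).
rewrite !ler_pdivrMr// => H1; rewrite mulrAC ler_pdivlMr// => H2.
rewrite mulrAC ler_pdivlMr//.
(* The product of [H1] and [H2] is the goal multiplied by [a k * b k]. *)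
rewrite -(ler_pM2l (mulr_gt0 ak bk)).
have := ler_pM (mulr_ge0 (ltW bk) (ltW ak1)) (mulr_ge0 (ltW ak) (ltW bl)) H1 H2.
congr (_ <= _); ring.
Qed.

Lemma sigmaj0 (R : realType) n (A : 'M[R]_n) : sigmaj 0 A = 1.
Proof.
rewrite /sigmaj expr0 mul1r subn0; have := char_poly_monic A.
by rewrite monicE /lead_coef size_char_poly => /eqP.
Qed.

(** Compare coefficients in [chi_(tA)(X) = t^n chi_A(X / t)]. *)
Lemma sigmajZ (R : realType) n (A : 'M[R]_n) (t : R) j : (j <= n)%N ->
  t != 0 -> sigmaj j (t *: A) = t ^+ j * sigmaj j A.
Proof.
move=> jn t0.
have E : char_poly (t *: A) = t ^+ n *: (char_poly A \Po (t^-1 *: 'X)).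
  rewrite /char_poly -det_map_mx -mul_polyC polyC_exp -detZ; congr (\det _).
  apply/matrixP => a b; rewrite !mxE /=.
  rewrite rmorphB/= comp_polyC rmorphMn/= comp_polyX mulrBr polyCM mulrnAr.
  congr (_ *+ _ - _).
  by rewrite -mul_polyC mulrA -polyCM divff// mul1r.
rewrite /sigmaj E coefZ.
have -> : (char_poly A \Po (t^-1 *: 'X))`_(n - j) =
    t^-1 ^+ (n - j) * (char_poly A)`_(n - j).
  rewrite coef_comp_poly size_char_poly.
  rewrite (bigD1 (Ordinal (leq_subr j n : (n - j < n.+1)%N)))//= big1 ?addr0 => [|i ij].
    by rewrite exprZn coefZ coefXn eqxx mulr1 mulrC.
  by rewrite exprZn coefZ coefXn -val_eqE/= eq_sym in ij *; rewrite (negPf ij) !mulr0.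
have -> : t ^+ n = t ^+ j * t ^+ (n - j) by rewrite -exprD subnKC.
have X : t ^+ (n - j) * t^-1 ^+ (n - j) = 1 by rewrite -exprMn divff// expr1n.
by rewrite -(mulrA (t ^+ j)) (mulrA (t ^+ (n - j))) X mul1r mulrCA.
Qed.

(** This is the coefficient inequality at index [n - j - 1]. The signs of [sigmaj j] and
    [sigmaj j.+1] are opposite, which reverses it. *)
Lemma sigmaj_rank1 (R : realType) n (A : 'M[R]_n) (v : 'rV[R]_n) j :
  A^T = A -> (j < n)%N ->
  sigmaj j (A + v^T *m v) * sigmaj j.+1 A <= sigmaj j A * sigmaj j.+1 (A + v^T *m v).
Proof.
move=> symA jn; rewrite /sigmaj exprS mulN1r.
have -> : (n - j = (n - j.+1).+1)%N by lia.
have := @char_poly_coef_rank1 R n A v (n - j.+1) symA.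
have -> : (n - j.+1 < n)%N by lia.
move/(_ isT); rewrite -(signr_odd _ j); case: odd; rewrite ?expr0 ?expr1; lra.
Qed.

(** * Nonnegative forms as sums of rank one forms *)

Definition psd {R : realType} {n} (P : 'M[R]_n) :=
  forall x : 'rV[R]_n, 0 <= (x *m P *m x^T) 0 0.

Lemma mx11_tr (K : comNzRingType) (X : 'M[K]_1) : X^T = X.
Proof. by apply/matrixP => i j; rewrite mxE !ord1. Qed.

Lemma quad_expand (R : realType) n (P : 'M[R]_n) (x y : 'rV[R]_n) s :
  P^T = P ->
  ((x + s *: y) *m P *m (x + s *: y)^T) 0 0 =
  (x *m P *m x^T) 0 0 + 2 * s * (x *m P *m y^T) 0 0 +
  s ^+ 2 * (y *m P *m y^T) 0 0.
Proof.
move=> symP.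
have C : y *m P *m x^T = x *m P *m y^T.
  by rewrite -[LHS]mx11_tr !trmx_mul trmxK symP mulmxA.
rewrite linearD/= linearZ/= !mulmxDl !mulmxDr -!scalemxAl -!scalemxAr C.
by rewrite !mxE; ring.
Qed.

Lemma mul_delta_tr (R : realType) n (x : 'rV[R]_n) i :
  (x *m (delta_mx (0 : 'I_1) i)^T) 0 0 = x 0 i.
Proof. by rewrite trmx_delta -colE mxE. Qed.

Lemma quad_delta (R : realType) n (P : 'M[R]_n) (i : 'I_n) :
  (delta_mx (0 : 'I_1) i *m P *m (delta_mx (0 : 'I_1) i)^T) 0 0 = P i i.
Proof. by rewrite mul_delta_tr -rowE mxE. Qed.

Lemma psd_diag_ge0 (R : realType) n (P : 'M[R]_n) i : psd P -> 0 <= P i i.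
Proof. by move=> /(_ (delta_mx 0 i)); rewrite quad_delta. Qed.

(** On [e_i + s e_j] the form takes the value [2 s P_ij], for both signs of [s]. *)
Lemma psd_diag0 (R : realType) n (P : 'M[R]_n) : P^T = P -> psd P ->
  (forall i, P i i = 0) -> P = 0.
Proof.
move=> symP psdP P0; apply/matrixP => i j; rewrite [RHS]mxE.
have H s : 0 <= 2 * s * P i j.
  have := psdP (delta_mx 0 i + s *: delta_mx 0 j).
  by rewrite quad_expand// !quad_delta !P0 mul_delta_tr -rowE mxE; lra.
have := H 1; have := H (-1); lra.
Qed.

(** One step of symmetric elimination. The last two clauses make the number of nonzero diagonal
    entries drop. *)
Lemma psd_rank1 (R : realType) n (P : 'M[R]_n) i : P^T = P -> psd P ->
  P i i != 0 ->
  let v := (Num.sqrt (P i i))^-1 *: row i P in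
  let Q := P - v^T *m v in
  [/\ Q^T = Q, psd Q, Q i i = 0 & forall j, P j j = 0 -> Q j j = 0].
Proof.
move=> symP psdP Pi0 v Q.
have Pi : 0 < P i i by rewrite lt0r Pi0 psd_diag_ge0.
have symQ : Q^T = Q by rewrite /Q linearB/= trmx_mul trmxK symP.
have vv a b : (v^T *m v) a b = P i a * P i b / P i i.
  rewrite !mxE big_ord1 !mxE mulrACA -expr2 exprVn sqr_sqrtr ?ltW//.
  by rewrite mulrC.
have psdQ : psd Q.
  (* This shift minimises [P] on the line through [x] in direction [e_i]; the minimum is the value
     of [Q] at [x]. *)
  move=> x; have := psdP (x + (- ((x *m P) 0 i / P i i)) *: delta_mx 0 i).
  rewrite quad_expand// quad_delta mul_delta_tr.
  have -> : (x *m Q *m x^T) 0 0 = (x *m P *m x^T) 0 0 - (x *m P) 0 i ^+ 2 / P i i.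
    rewrite /Q mulmxBr mulmxBl [LHS]mxE [X in _ + X]mxE; congr (_ - _).
    have E : x *m v^T = ((Num.sqrt (P i i))^-1 * (x *m P) 0 i)%:M.
      rewrite [LHS]mx11_scalar; congr (_%:M); rewrite !mxE mulr_sumr.
      apply: eq_bigr => a _; rewrite !mxE mulrCA; congr (_ * (_ * _)).
      by rewrite -[in LHS]symP mxE.
    rewrite mulmxA -mulmxA -[v *m x^T]mx11_tr trmx_mul trmxK E.
    rewrite -scalar_mxM mxE eqxx mulr1n mulrACA -!expr2 exprVn sqr_sqrtr ?ltW//.
    by rewrite mulrC.
  congr (_ <= _); by field.
split=> //.
  by rewrite /Q [LHS]mxE [X in _ + X]mxE vv -mulrA divff// mulr1 subrr.
move=> j Pj; apply/eqP; rewrite eq_le psd_diag_ge0// andbT.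
rewrite /Q [X in X <= _]mxE [X in _ + X]mxE vv Pj sub0r oppr_le0.
by rewrite divr_ge0 ?(ltW Pi)// -expr2 sqr_ge0.
Qed.

(** Induction on the number of nonzero diagonal entries of [P], peeling off one rank one form each
    time. Positivity is carried along because the next step starts from the updated matrix. *)
Lemma sigmaj_psd (R : realType) n k (A P : 'M[R]_n) :
  (k <= n)%N -> A^T = A -> P^T = P -> psd P ->
  (forall i, (i <= k)%N -> 0 < sigmaj i A) ->
  (forall i, (i <= k)%N -> 0 < sigmaj i (A + P)) /\
  (forall l, (l <= k)%N ->
    sigmaj k A / sigmaj l A <= sigmaj k (A + P) / sigmaj l (A + P)).
Proof.
move=> kn; have [m] := ubnP #|[set i | P i i != 0]%SET|.
elim: m A P => // m IH A P; rewrite ltnS => Pm symA symP psdP GA.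
have [P0|] := boolP [forall i, P i i == 0].
  rewrite (psd_diag0 R n P) ?addr0//; last by move=> i; apply/eqP/(forallP P0).
rewrite negb_forall => /existsP[i Pi].
have [] := psd_rank1 R n P i symP psdP Pi.
set v := _ *: row i P; set Q := P - _ => symQ psdQ Qi QP.
have symB : (A + v^T *m v)^T = A + v^T *m v.
  by rewrite linearD/= trmx_mul trmxK symA.
have [||GB HB] := @ratio_chain R (fun j => sigmaj j A)
    (fun j => sigmaj j (A + v^T *m v)) k GA.
- by rewrite sigmaj0.
- by move=> j jk; apply: sigmaj_rank1 => //; exact: leq_trans kn.
have <- : A + v^T *m v + Q = A + P by rewrite /Q -addrA [_ + (P - _)]addrC subrK.
have [|GC HC] := IH (A + v^T *m v) Q _ symB symQ psdQ GB.
  apply: leq_trans Pm; apply: proper_card; apply/properP; split.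
    apply/fintype.subsetP => j; rewrite !inE; apply: contra => /eqP/QP->//.
  by exists i; rewrite !inE ?Qi ?eqxx.
by split=> // l lk; exact: le_trans (HB l lk) (HC l lk).
Qed.

(** * One-variable tests and second derivatives *)

Lemma is_derive_line (R : realType) m (F : 'rV[R]_m -> R) x v (s : R) :
  differentiable F (x + s *: v) ->
  is_derive s (1 : R) (fun r : R => F (x + r *: v)) ('D_v F (x + s *: v)).
Proof.
move=> dF; have dv : derivable F (x + s *: v) v by exact: diff_derivable.
have E : (fun h : R => h^-1 *: (F (x + (h *: (1 : R) + s) *: v) - F (x + s *: v))) =
         (fun h : R => h^-1 *: (F (h *: v + (x + s *: v)) - F (x + s *: v))).
  apply/funext => h; congr (_ *: (F _ - _)).
  by rewrite [h *: _]mulr1 scalerDl addrCA.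
by apply: DeriveDef; rewrite /derivable /derive/= E.
Qed.

Lemma mvt0 (R : realType) (f df : R -> R) (s : R) : 0 < s ->
  (forall r, 0 <= r <= s -> is_derive r (1 : R) f (df r)) ->
  exists2 c, 0 < c < s & f s - f 0 = df c * s.
Proof.
move=> s0 H.
have [||c] := @MVT R f df 0 s s0.
- by move=> r; rewrite in_itv/= => /andP[r0 rs]; apply: H; rewrite !ltW.
- apply: derivable_within_continuous => r; rewrite in_itv/= => /H rd.
  exact: ex_derive.
by rewrite in_itv/= subr0 => c0 E; exists c.
Qed.

Lemma derive_lt0_right (R : realType) (f : R -> R) (d : R) :
  is_derive (0 : R) (1 : R) f d -> f 0 = 0 -> d < 0 ->
  exists2 e, 0 < e & forall s, 0 < s < e -> f s < 0.
Proof.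
move=> [df fd] f0 d0.
have : (fun h : R => h^-1 *: (f (h *: (1 : R) + 0) - f 0)) @ 0^' --> d.
  by rewrite -fd; exact: df.
move/cvgr_lt => /(_ _ d0); rewrite near_withinE /= => /nbhs_ballP[e /= e0 He].
exists e => // s /andP[s0 se].
have /= := He s; rewrite /ball/= sub0r normrN gtr0_norm// => /(_ se).
rewrite gt_eqF// => /(_ isT); rewrite addr0 f0 subr0 [s *: _]mulr1.
by rewrite pmulr_rlt0// invr_gt0.
Qed.

Lemma derive_ge0_right (R : realType) (f : R -> R) (d e : R) : 0 < e ->
  is_derive (0 : R) (1 : R) f d -> f 0 = 0 ->
  (forall s, 0 < s < e -> 0 <= f s) -> 0 <= d.
Proof.
move=> e0 df f0 H; rewrite leNgt; apply/negP => d0.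
have [e' e'0 H'] := derive_lt0_right R f d df f0 d0.
pose s := Num.min e e' / 2.
have s0 : 0 < s by rewrite divr_gt0// lt_min e0.
have [se se'] : s < e /\ s < e'.
  by split; rewrite /s; case: (leP e e'); lra.
by have := H s; rewrite s0 se leNgt H' ?s0// => /(_ isT).
Qed.

(** If [d < 0], then [df] is negative just after 0, and so is [f] by the mean value theorem. The
    sign of [f] is asked for on the right only, since at a boundary point of the cap the other side
    may be outside the cone. *)
Lemma derive2_ge0_right (R : realType) (f df : R -> R) (d e : R) : 0 < e ->
  (forall s, 0 <= s < e -> is_derive s (1 : R) f (df s)) ->
  is_derive (0 : R) (1 : R) df d -> f 0 = 0 -> df 0 = 0 ->
  (forall s, 0 < s < e -> 0 <= f s) -> 0 <= d.
Proof.
move=> e0 dF ddF f0 df0 H; rewrite leNgt; apply/negP => d0.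
have [e' e'0 H'] := derive_lt0_right R df d ddF df0 d0.
pose s := Num.min e e' / 2.
have s0 : 0 < s by rewrite divr_gt0// lt_min e0.
have [se se'] : s < e /\ s < e'.
  by split; rewrite /s; case: (leP e e'); lra.
have [|c /andP[c0 cs]] := mvt0 R f df s s0.
  by move=> r /andP[r0 rs]; apply: dF; rewrite r0 (le_lt_trans rs).
rewrite f0 subr0 => E; have := H s; rewrite s0 se => /(_ isT).
rewrite E pmulr_lge0// leNgt H'// c0 (lt_trans cs)//.
Qed.

(** * Symmetry and bilinearity of second derivatives *)

Definition hess {R : realType} {m} (F : 'rV[R]_m -> R) x v w :=
  Defs.iterD [:: v; w] F x.

Section Hessian.
Variables (R : realType) (m : nat) (U : set 'rV[R]_m) (F : 'rV[R]_m -> R).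
Hypotheses (oU : open U) (C2F : C2_on U F).

Lemma C2_on_diff x : U x -> differentiable F x.
Proof. by move=> /(C2F [::])[/(_ isT)]. Qed.

Lemma C2_on_diff1 x w : U x -> differentiable (fun y => 'D_w F y) x.
Proof. by move=> /(C2F [:: w])[/(_ isT)]. Qed.

Lemma hess_cont x v w : U x -> hess F y v w @[y --> x] --> hess F x v w.
Proof. by move=> /(C2F [:: v; w])[_ /(_ erefl)]. Qed.

(** The mean value theorem along [v] for the increment in direction [w], then along [w] for the
    resulting derivative. *)
Lemma mixed_difference (x v w : 'rV[R]_m) (s : R) : 0 < s ->
  (forall a b, 0 <= a <= s -> 0 <= b <= s -> U (x + a *: v + b *: w)) ->
  exists a b, [/\ 0 <= a <= s, 0 <= b <= s &
   (F (x + s *: v + s *: w) - F (x + s *: v)) - (F (x + s *: w) - F x) =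
   hess F (x + a *: v + b *: w) w v * s * s].
Proof.
move=> s0 H.
pose f a := F (x + s *: w + a *: v) - F (x + a *: v).
have AC a b : x + a *: v + b *: w = x + b *: w + a *: v by rewrite addrAC.
have Us a : 0 <= a <= s -> U (x + s *: w + a *: v).
  by move=> a0; rewrite -AC; apply: H => //; rewrite lexx ltW.
have U0 a : 0 <= a <= s -> U (x + a *: v).
  move=> a0; have := H a 0 a0; rewrite scale0r addr0; apply.
  by rewrite lexx ltW.
have [a|a /andP[a0 as_]] := mvt0 R f
    (fun a => 'D_v F (x + s *: w + a *: v) - 'D_v F (x + a *: v)) s s0.
  move=> a0; apply: is_deriveB; apply: is_derive_line; apply: C2_on_diff.
    exact: Us.
  exact: U0.
have a0s : 0 <= a <= s by rewrite !ltW.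
have [b b0|b /andP[b0 bs]] := mvt0 R (fun b => 'D_v F (x + a *: v + b *: w))
    (fun b => hess F (x + a *: v + b *: w) w v) s s0.
  apply: (is_derive_line R m (fun y => 'D_v F y)).
  by apply: C2_on_diff1; apply: H.
rewrite scale0r addr0 => Eb Ea.
exists a, b; split => //; first by rewrite !ltW.
rewrite -Eb [x + a *: v + _]AC -Ea /f !scale0r !addr0 [x + s *: v + _]AC; ring.
Qed.


Local Opaque hess.

(** Schwarz's theorem. The mixed second difference is symmetric in [v] and [w], so the two mixed
    derivatives agree at two points near [x]; by continuity each moves by less than half their
    supposed distance [d]. *)
Lemma hess_sym x v w : U x -> hess F x v w = hess F x w v.
Proof.
move=> Ux; apply/eqP; rewrite -subr_eq0 -normr_le0 leNgt; apply/negP => d0.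
set d := `| _ | in d0.
have d20 : 0 < d / 2 by rewrite divr_gt0.
have N : \forall y \near x, [/\ U y, `|hess F x v w - hess F y v w| < d / 2 &
   `|hess F x w v - hess F y w v| < d / 2].
  have n1 : \forall y \near x, U y by exact: open_nbhs_nbhs.
  have n2 v' w' : \forall y \near x, `|hess F x v' w' - hess F y v' w'| < d / 2.
    have := hess_cont x v' w' Ux.
    by move=> /cvgr_dist_lt; apply.
  by apply: filterS3 n1 (n2 v w) (n2 w v) => y; split.
have [e /= e0 He] := (nbhs_ballP _ _).1 N.
(* Small enough for the parallelogram spanned by [s *: v] and [s *: w] at [x] to lie in the ball. *)
pose s := e / (`|v| + `|w| + 1).
have M0 : 0 < `|v| + `|w| + 1 by rewrite ltr_wpDl// addr_ge0.
have s0 : 0 < s by rewrite divr_gt0.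
have B v' w' a b : `|v'| + `|w'| = `|v| + `|w| -> 0 <= a <= s -> 0 <= b <= s ->
    ball x e (x + a *: v' + b *: w').
  move=> vw /andP[a0 as_] /andP[b0 bs].
  rewrite -ball_normE /= -addrA opprD addNKr opprD.
  apply: le_lt_trans (_ : s * (`|v| + `|w|) < e).
    rewrite -opprD normrN (le_trans (ler_normD _ _))// !normrZ !ger0_norm//.
    by rewrite -vw mulrDr lerD// ler_wpM2r.
  by rewrite /s mulrAC ltr_pdivrMr// ltr_pM2l// ltrDl.
clearbody s.
have [|a [b [a0 b0 E1]]] := mixed_difference x v w s s0.
  by move=> a b a0 b0; have [] := He _ (B v w a b erefl a0 b0).
have wv : `|w| + `|v| = `|v| + `|w| by rewrite addrC.
have [|a' [b' [a'0 b'0 E2]]] := mixed_difference x w v s s0.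
  by move=> a' b' a0' b0'; have [] := He _ (B w v a' b' wv a0' b0').
have E : hess F (x + a *: v + b *: w) w v = hess F (x + a' *: w + b' *: v) v w.
  have ss : s * s != 0 by rewrite mulf_neq0 ?gt_eqF.
  have gen (L1 L2 A1 A2 : R) :
      L1 = A1 * s * s -> L2 = A2 * s * s -> L1 = L2 -> A1 = A2.
    by move=> -> ->; rewrite -!mulrA => /(mulIf ss).
  apply: gen E1 E2 _.
  have swap (a1 a2 a3 a4 : R) : a1 - a2 - (a3 - a4) = a1 - a3 - (a2 - a4) by ring.
  rewrite swap.
  by rewrite (addrAC x).
have [_ _ h1] := He _ (B v w a b erefl a0 b0).
have [_ h2 _] := He _ (B w v a' b' wv a'0 b'0).
move: h1 h2; rewrite E => h1 h2.
have : d < d / 2 + d / 2.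
  have tri (a1 a2 a3 : R) : `|a1 - a2| <= `|a1 - a3| + `|a2 - a3|.
    by rewrite (distrC a2) ler_distD.
  exact: le_lt_trans (tri _ _ _) (ltrD h2 h1).
by rewrite -splitr ltxx.
Qed.

Local Transparent hess.

Lemma hess_linl x a u v w : U x ->
  hess F x (a *: u + v) w = a * hess F x u w + hess F x v w.
Proof.
move=> Ux; rewrite /hess /= !deriveE ?linearP//; exact: C2_on_diff1.
Qed.

Local Opaque hess.

(** The first slot is the outer derivative, linear as a differential; symmetry transfers this to the
    second slot. *)
Lemma hess_linr x a u v w : U x ->
  hess F x w (a *: u + v) = a * hess F x w u + hess F x w v.
Proof. by move=> Ux; rewrite !(hess_sym x w)// hess_linl. Qed.

Lemma hess_mulmx x n (y : 'rV[R]_n) (b : 'M[R]_(n, m)) : U x ->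
  hess F x (y *m b) (y *m b) =
  (y *m (\matrix_(i, j) hess F x (row i b) (row j b)) *m y^T) 0 0.
Proof.
move=> Ux; rewrite mxE mulmx_sum_row.
have L0 w : hess F x 0 w = 0.
  by have := hess_linl x 1 0 0 w Ux; rewrite scaler0 addr0 mul1r -[LHS]addr0 => /addrI.
have L w : hess F x (\sum_i y 0 i *: row i b) w = \sum_i y 0 i * hess F x (row i b) w.
  elim/big_ind2 : _ => // [r1 v1 r2 v2 h1 h2|i _].
    by have := hess_linl x 1 v1 v2 w Ux; rewrite scale1r mul1r h1 h2.
  by have := hess_linl x (y 0 i) (row i b) 0 w Ux; rewrite !addr0 L0 addr0.
rewrite L; under [RHS]eq_bigr do rewrite !mxE mulr_suml.
rewrite exchange_big/=; apply: eq_bigr => i _.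
rewrite hess_sym// L mulr_sumr; apply: eq_bigr => j _.
by rewrite !mxE mulrA mulrAC hess_sym.
Qed.

End Hessian.

Local Opaque hess.

(** * Geometry of the cap *)

Section Dot.
Variables (R : realType) (m : nat).
Implicit Types u v w : 'rV[R]_m.

Lemma dotvC u v : dotv u v = dotv v u.
Proof. by apply: eq_bigr => i _; rewrite mulrC. Qed.

Lemma dotvDl u v w : dotv (u + v) w = dotv u w + dotv v w.
Proof. by rewrite /dotv -big_split; apply: eq_bigr => i _; rewrite mxE mulrDl. Qed.

Lemma dotvZl a u w : dotv (a *: u) w = a * dotv u w.
Proof. by rewrite /dotv mulr_sumr; apply: eq_bigr => i _; rewrite mxE mulrA. Qed.

Lemma dotvDr u v w : dotv w (u + v) = dotv w u + dotv w v.
Proof. by rewrite !(dotvC w) dotvDl. Qed.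

Lemma dotvZr a u w : dotv w (a *: u) = a * dotv w u.
Proof. by rewrite !(dotvC w) dotvZl. Qed.

Lemma dotvNl u w : dotv (- u) w = - dotv u w.
Proof. by rewrite -scaleN1r dotvZl mulN1r. Qed.

Lemma dotvNr u w : dotv w (- u) = - dotv w u.
Proof. by rewrite !(dotvC w) dotvNl. Qed.

Lemma dotv_ge0 u : 0 <= dotv u u.
Proof. by apply: sumr_ge0 => i _; rewrite -expr2 sqr_ge0. Qed.

Lemma dotv_delta i u : dotv (delta_mx 0 i) u = u 0 i.
Proof.
rewrite /dotv (bigD1 i)//= mxE !eqxx mul1r big1 ?addr0// => j ji.
by rewrite mxE (negPf ji) andbF mul0r.
Qed.

Lemma dotv_mulmxl n (y : 'rV[R]_n) (b : 'M[R]_(n, m)) u :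
  (forall i, dotv (row i b) u = 0) -> dotv (y *m b) u = 0.
Proof.
move=> H; rewrite mulmx_sum_row.
elim/big_ind : _ => [|v w hv hw|i _].
- by rewrite -[X in dotv X](scale0r (0 : 'rV[R]_m)) dotvZl mul0r.
- by rewrite dotvDl hv hw addr0.
- by rewrite dotvZl H mulr0.
Qed.

Lemma enorm_eq1 u : enorm u = 1 <-> dotv u u = 1.
Proof.
rewrite /enorm; split => [H|->]; last exact: sqrtr1.
by rewrite -(sqr_sqrtr (dotv_ge0 u)) H expr1n.
Qed.

Lemma enormZ a u : 0 <= a -> enorm (a *: u) = a * enorm u.
Proof.
move=> a0; rewrite /enorm dotvZl dotvZr mulrA -expr2 sqrtrM ?sqr_ge0//.
by rewrite sqrtr_sqr ger0_norm.
Qed.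

End Dot.

(** Applied with [a] the height of a point of the cap, [Xm] the vertical component of a direction
    and [N] its squared length. *)
Lemma small_slope (R : realType) (a Xm N : R) : 0 <= N -> 0 <= a ->
  (0 < a \/ 0 < Xm) ->
  exists2 e : R, 0 < e & forall s : R, 0 < s < e -> s ^+ 2 * N <= a + s * Xm.
Proof.
move=> N0 a0 aX.
have [M M0 XM] : exists2 M : R, 0 <= M & - Xm <= M.
  by exists `|Xm|; rewrite // -normrN ler_norm.
case: aX => [a1|X1].
  have d0 : 0 < a + M + N + 1 by rewrite ltr_wpDl// addr_ge0// addr_ge0.
  (* This bound gives [s < 1] and [s (M + N) < a], hence [s^2 N <= s N <= a - s M <= a + s Xm]. *)
  exists (a / (a + M + N + 1)); first by rewrite divr_gt0.
  move=> s /andP[s0 se].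
  have sa : s * (a + M + N + 1) < a by rewrite -ltr_pdivlMr.
  have sP : 0 <= s * (M + N + 1) by rewrite mulr_ge0 ?ltW// ltr_wpDl// addr_ge0.
  have sa1 : s * a < a by lra.
  have s1 : s < 1 by rewrite -(ltr_pM2r a1) mul1r.
  have MX : 0 <= M + Xm by lra.
  have sX : 0 <= s * (M + Xm) by rewrite mulr_ge0// ltW.
  have sN : 0 <= s * N by rewrite mulr_ge0// ltW.
  have ssN : s ^+ 2 * N <= s * N.
    by rewrite expr2 -mulrA ler_piMl// ltW.
  have sa0 : 0 <= s * a by rewrite mulr_ge0// ltW.
  lra.
exists (Xm / (N + 1)); first by rewrite divr_gt0// ltr_wpDl.
move=> s /andP[s0 se].
have sX : s * (N + 1) < Xm by rewrite -ltr_pdivlMr// ltr_wpDl.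
have sX2 : s * (s * (N + 1)) <= s * Xm by rewrite ler_pM2l// ltW.
have ss : 0 <= s * s by rewrite mulr_ge0 ?ltW.
lra.
Qed.

(* The rows are the images of the first [n] basis vectors under the reflection
   exchanging [nu] and [- E_(n+1)]. *)
Lemma orthonormal_complement (R : realType) n (nu : 'rV[R]_n.+1) :
  dotv nu nu = 1 -> 0 < 1 + nu 0 ord_max ->
  exists b : 'M[R]_(n, n.+1),
    (forall i j, dotv (row i b) (row j b) = (i == j)%:R) /\
    (forall i, dotv (row i b) nu = 0).
Proof.
move=> nn num; set q := 1 + nu 0 ord_max in num.
pose e (i : 'I_n) : 'rV[R]_n.+1 := delta_mx 0 (widen_ord (leqnSn n) i).
have mi i : (widen_ord (leqnSn n) i == ord_max) = false.
  by apply/negbTE; rewrite -val_eqE/= neq_ltn ltn_ord.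
have [w [wnu ww we]] : exists w : 'rV[R]_n.+1,
    [/\ dotv w nu = q, dotv w w = 2 * q & forall i, dotv w (e i) = dotv nu (e i)].
  exists (nu + delta_mx 0 ord_max); split.
  - by rewrite dotvDl dotv_delta nn.
  - rewrite !dotvDl !dotvDr nn (dotvC _ _ nu (delta_mx _ _)) !dotv_delta mxE !eqxx /q/=.
    ring.
  - by move=> i; rewrite dotvDl dotv_delta mxE eq_sym mi andbF addr0.
(* The reflection [e - 2 (e . w) / (w . w) w] for [w = nu + E_(n+1)], simplified by the three
   identities for [w]. *)
pose f i := e i - (dotv nu (e i) / q) *: w.
have q0 : q != 0 by exact: lt0r_neq0.
clearbody q; exists (\matrix_(i < n) f i); split=> [i j|i]; rewrite !rowK /f.
  rewrite !(dotvDl _ _ (e i)) !(dotvDr _ _ (e j)) !dotvNl !dotvNr !dotvZl !dotvZr.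
  rewrite (dotvC _ _ (e i) w) !we ww.
  have -> : dotv (e i) (e j) = (i == j)%:R.
    by rewrite dotv_delta mxE eqxx /= -val_eqE.
  by field.
rewrite dotvDl dotvNl dotvZl wnu (dotvC _ _ (e i)); field; exact: q0.
Qed.

Section Cap.
Variables (R : realType) (n : nat) (theta : R).
Implicit Types (x xi X : 'rV[R]_n.+1) (h : 'rV[R]_n.+1 -> R).
Local Notation c := (ccenter n theta).

Lemma Elast_delta : Elast n = delta_mx 0 ord_max :> 'rV[R]_n.+1.
Proof. by apply/rowP => i; rewrite !mxE; case: eqP. Qed.

Lemma ccenter_last : c 0 ord_max = - cos theta.
Proof. by rewrite !mxE eqxx mulrN1. Qed.

Lemma capP xi : cap n theta xi <->
  0 <= xi 0 ord_max /\ dotv (xi - c) (xi - c) = 1.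
Proof. by split => -[? /enorm_eq1]. Qed.

Lemma hext_ray h xi r : cap n theta xi -> 0 < r ->
  hext n theta h (c + r *: (xi - c)) = r * h xi.
Proof.
move=> [_ xi1] r0; rewrite /hext [c + _]addrC addrK enormZ ?ltW// xi1 mulr1.
by rewrite scalerA mulVf ?gt_eqF// scale1r addrC subrK.
Qed.

Lemma hext_cap h xi : cap n theta xi -> hext n theta h xi = h xi.
Proof.
move=> /(hext_ray h xi 1)/(_ ltr01).
by rewrite scale1r addrC subrK mul1r.
Qed.

Lemma cap_compact : compact (cap n theta).
Proof.
pose A (i : 'I_n.+1) := `[c 0 i - 1, c 0 i + 1]%classic : set R.
have cA : compact [set v : 'rV[R]_n.+1 | forall i, A i (v ord0 i)].
  by apply: rV_compact => i; exact: segment_compact.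
apply: (subclosed_compact _ cA); last first.
  move=> x /capP[_ xc] i; rewrite /A/= in_itv/=.
  have : (x 0 i - c 0 i) ^+ 2 <= 1.
    rewrite -xc /dotv (bigD1 i)//= !mxE -expr2 lerDl; apply: sumr_ge0 => j _.
    by rewrite -expr2 sqr_ge0.
  by move=> H; apply/andP; split; nra.
have -> : cap n theta = (fun x : 'rV[R]_n.+1 => x 0 ord_max) @^-1` [set y | 0 <= y]
    `&` (fun x => dotv (x - c) (x - c)) @^-1` [set y | y = 1].
  by apply/seteqP; split => x /capP.
apply: closedI.
  apply: preimage_closed; last exact: closed_ge.
  by move=> x _; exact: coord_continuous.
apply: preimage_closed; last exact: closed_eq.
move=> x _; move: x; apply: continuous_big; first exact: add_continuous.
move=> i _ x.
have H : {for x, continuous (fun y : 'rV[R]_n.+1 => (y - c) 0 i)}.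
  rewrite (_ : (fun y => _) = (fun y : 'rV[R]_n.+1 => y 0 i) \- cst (c 0 i)).
    by apply: continuousB; [exact: coord_continuous | exact: cst_continuous].
  by apply/funext => y; rewrite !mxE.
exact: (continuousM H H).
Qed.

(** The radial projection of [xi + s X] to the sphere divides by [r = sqrt (1 + s^2 |X|^2)]. This
    costs height of order [s^2] only, which [small_slope] absorbs. *)
Lemma cap_inward xi X : cap n theta xi -> dotv X (xi - c) = 0 ->
  (0 < xi 0 ord_max \/ 0 < X 0 ord_max) ->
  exists2 e : R, 0 < e & forall s : R, 0 < s < e ->
    exists (r : R) zeta,
      [/\ 0 < r, cap n theta zeta & xi + s *: X = c + r *: (zeta - c)].
Proof.
move=> /capP[a0 xic] Xnu aX; set a := xi 0 ord_max in a0 aX.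
set Xm := X 0 ord_max in aX; pose N := dotv X X.
have N0 : 0 <= N := dotv_ge0 R _ X.
have [e e0 He] := small_slope R a Xm N N0 a0 aX.
exists e => // s /[dup] /andP[s0 _] /He {}He.
pose r := Num.sqrt (1 + s ^+ 2 * N).
have sN0 : 0 <= s ^+ 2 * N by rewrite mulr_ge0// sqr_ge0.
have r2 : r ^+ 2 = 1 + s ^+ 2 * N by rewrite sqr_sqrtr// addr_ge0.
have r1 : 1 <= r by rewrite -[leLHS]sqrtr1 ler_wsqrtr// lerDl.
have r0 : 0 < r by exact: lt_le_trans r1.
pose nu := xi - c + s *: X.
have nn : dotv nu nu = r ^+ 2.
  rewrite r2 /nu !(dotvDl R _ (_ - _)) !(dotvDr R _ (_ - _)) !(dotvZl, dotvZr).
  by rewrite xic (dotvC _ _ (xi - c)) Xnu -/N; ring.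
exists r, (c + r^-1 *: nu); split => //.
  apply/capP; rewrite [c + _]addrC addrK dotvZl dotvZr nn; split; last first.
    by field; rewrite gt_eqF.
  have -> : (r^-1 *: nu + c) 0 ord_max =
      (a + cos theta + s * Xm) / r - cos theta.
    by rewrite /nu /a /Xm !mxE eqxx; ring.
  rewrite subr_ge0 ler_pdivlMr//.
  (* What remains is [cos theta (r - 1) <= a + s Xm]. It follows from [cos theta <= 1] and
     [r - 1 <= r^2 - 1 = s^2 N]. *)
  have r10 : 0 <= r - 1 by lra.
  have rr : r - 1 <= s ^+ 2 * N.
    have : 0 <= (r - 1) * r by rewrite mulr_ge0// ltW.
    lra.
  have c1 : 0 <= 1 - cos theta by rewrite subr_ge0 cos_le1.
  have : 0 <= (1 - cos theta) * (r - 1) by rewrite mulr_ge0.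
  lra.
rewrite [c + _ - c]addrC addKr scalerA divff ?gt_eqF// scale1r /nu.
by rewrite addrA [c + _]addrC subrK.
Qed.

Hypothesis theta_lt : 0 < theta < pi.

Lemma cos_gtN1 : -1 < cos theta.
Proof.
have := sin_gt0_pi theta_lt; have := cos2Dsin2 theta => H s0.
rewrite ltNge; apply/negP => c1.
have : 0 < sin theta ^+ 2 by rewrite exprn_gt0.
have : 0 <= (- 1 - cos theta) * (1 - cos theta) by rewrite mulr_ge0; lra.
lra.
Qed.

(** The normal [xi - c] has last coordinate at least [cos theta > -1], so it is not [- E_(n+1)] and
    the reflection is defined. *)
Lemma tframe_exists xi : cap n theta xi -> exists b, tframe n theta xi b.
Proof.
move=> /capP[xi0 xic]; apply: orthonormal_complement => //.
by rewrite mxE [(- c) 0 ord_max]mxE ccenter_last opprK; have := cos_gtN1; lra.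
Qed.

End Cap.

(** * Comparison at a touching point *)

Lemma open_ray (R : realType) m (U : set 'rV[R]_m) x v : open U -> U x ->
  exists2 e : R, 0 < e & forall s : R, 0 <= s < e -> U (x + s *: v).
Proof.
move=> oU Ux; have /nbhs_ballP[r /= r0 Hr] : nbhs x U by exact: open_nbhs_nbhs.
have v0 : 0 < `|v| + 1 by rewrite ltr_wpDl.
exists (r / (`|v| + 1)); first by rewrite divr_gt0.
move=> s /andP[s0]; rewrite ltr_pdivlMr// => sr; apply: Hr.
rewrite -ball_normE /= opprD addNKr normrN normrZ ger0_norm//.
by apply: le_lt_trans sr; rewrite ler_wpM2l// lerDl.
Qed.

Lemma quad_ge0_limit (R : realType) (a b c : R) :
  (forall e, 0 < e -> 0 <= e ^+ 2 * a + e * b + c) -> 0 <= c.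
Proof.
move=> H; rewrite leNgt; apply/negP => c0.
have [A A0 aA] : exists2 A : R, 0 <= A & a <= A by exists `|a|; rewrite ?ler_norm.
have [B B0 bB] : exists2 B : R, 0 <= B & b <= B by exists `|b|; rewrite ?ler_norm.
have M0 : 0 < A + B + 1 - c by lra.
(* For this [e], which is at most 1, the quadratic is at most [e (A + B) + c = - e (1 - c) < 0]. *)
pose e := - c / (A + B + 1 - c).
have e0 : 0 < e by rewrite divr_gt0// oppr_gt0.
have eM : e * (A + B + 1 - c) = - c by rewrite divfK// gt_eqF.
have e1 : e <= 1 by rewrite ler_pdivrMr// mul1r; lra.
have He : 0 <= e ^+ 2 * a + e * b + c := H e e0.
clearbody e.
have ea : e ^+ 2 * a <= e ^+ 2 * A by rewrite ler_wpM2l// sqr_ge0.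
have eA : e ^+ 2 * A <= e * A.
  by rewrite expr2 -mulrA ler_piMl// mulr_ge0// ltW.
have eb : e * b <= e * B by rewrite ler_wpM2l// ltW.
have ec : 0 <= e * - c by rewrite mulr_ge0 ?ltW// oppr_gt0.
lra.
Qed.

Lemma derive_lin (R : realType) m (F : 'rV[R]_m -> R) x a X Y :
  differentiable F x -> 'D_(a *: X + Y) F x = a * 'D_X F x + 'D_Y F x.
Proof. by move=> dF; rewrite !deriveE// linearP. Qed.

Section Conormal.
Variables (R : realType) (n : nat) (theta : R).
Hypothesis theta_lt : 0 < theta < pi.
Local Notation c := (ccenter n theta).

Lemma conormal_last xi : bcap n theta xi ->
  conormal n theta xi 0 ord_max = - sin theta.
Proof.
move=> [_ xi0]; have s0 := sin_gt0_pi theta_lt; have cs := cos2Dsin2 theta.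
rewrite /conormal !mxE eqxx xi0.
have -> : -1 + cos theta * (0 - cos theta * -1) = - sin theta * sin theta by lra.
by field; rewrite gt_eqF.
Qed.

Lemma conormal_tangent xi : bcap n theta xi ->
  dotv (conormal n theta xi) (xi - c) = 0.
Proof.
move=> [/capP[_ xic] xi0]; rewrite /conormal dotvZl dotvDl dotvZl xic /evec.
rewrite dotvNl Elast_delta dotv_delta mxE [(- c) 0 _]mxE ccenter_last xi0.
by ring.
Qed.

End Conormal.

Section Touching.
Variables (R : realType) (n : nat) (theta t : R) (h1 h2 : 'rV[R]_n.+1 -> R).
Variables (U : set 'rV[R]_n.+1) (x0 : 'rV[R]_n.+1).
Hypothesis theta_lt : 0 < theta < pi.
Hypotheses (oU : open U) (capU : cap n theta `<=` U).
Local Notation H1 := (hext n theta h1).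
Local Notation H2 := (hext n theta h2).
Local Notation nu := (x0 - ccenter n theta).
Hypotheses (C2H1 : C2_on U H1) (C2H2 : C2_on U H2).
Hypothesis x0cap : cap n theta x0.
Hypothesis le12 : forall xi, cap n theta xi -> h1 xi <= t * h2 xi.
Hypothesis eq12 : h1 x0 = t * h2 x0.
Hypothesis robin1 : bcap n theta x0 ->
  'D_(conormal n theta x0) H1 x0 = cos theta / sin theta * h1 x0.
Hypothesis robin2 : bcap n theta x0 ->
  'D_(conormal n theta x0) H2 x0 = cos theta / sin theta * h2 x0.

Let Ux0 : U x0. Proof. exact: capU. Qed.

Let gap X (s : R) := t * H2 (x0 + s *: X) - H1 (x0 + s *: X).
Let dgap X (s : R) := t * 'D_X H2 (x0 + s *: X) - 'D_X H1 (x0 + s *: X).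
Let slope X := t * 'D_X H2 x0 - 'D_X H1 x0.
Let curv X := t * hess H2 x0 X X - hess H1 x0 X X.
(** Ensures that the segment from [x0] along [X] starts inside the cone over the cap. *)
Let inward X := dotv X nu = 0 /\ (0 < x0 0 ord_max \/ 0 < X 0 ord_max).

Lemma gap0 X : gap X 0 = 0.
Proof. by rewrite /gap scale0r addr0 !hext_cap// eq12 subrr. Qed.

(** By homogeneity the gap at a point of the cone is a positive multiple of [t * h2 - h1] at its
    projection to the cap. *)
Lemma gap_ge0 X : inward X ->
  exists2 e : R, 0 < e & forall s, 0 < s < e -> 0 <= gap X s.
Proof.
move=> [Xnu aX]; have [e e0 He] := cap_inward R n theta x0 X x0cap Xnu aX.
exists e => // s /He[r [z [r0 zc E]]].
rewrite /gap E !hext_ray// mulrCA -mulrBr mulr_ge0 ?(ltW r0)// subr_ge0.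
exact: le12.
Qed.

Lemma is_derive_gap X s : U (x0 + s *: X) ->
  is_derive s (1 : R) (gap X) (dgap X s).
Proof.
move=> Us; have d1 := C2_on_diff R _ U H1 C2H1 _ Us.
have d2 := C2_on_diff R _ U H2 C2H2 _ Us.
apply: is_deriveB; last exact: is_derive_line.
by apply: (@is_deriveZ _ _ _ _ t); exact: is_derive_line.
Qed.

Lemma is_derive_dgap X : is_derive (0 : R) (1 : R) (dgap X) (curv X).
Proof.
have Us : U (x0 + (0 : R) *: X) by rewrite scale0r addr0.
have d1 := C2_on_diff1 R _ U H1 C2H1 _ X Us.
have d2 := C2_on_diff1 R _ U H2 C2H2 _ X Us.
have := @is_derive_line R _ (fun y => 'D_X H1 y) x0 X 0 d1.
have := @is_derive_line R _ (fun y => 'D_X H2 y) x0 X 0 d2.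
rewrite scale0r addr0 => e2 e1.
by apply: is_deriveB; apply: (@is_deriveZ _ _ _ _ t).
Qed.

Lemma slope_ge0 X : inward X -> 0 <= slope X.
Proof.
move=> /gap_ge0[e e0 He]; have Us : U (x0 + (0 : R) *: X) by rewrite scale0r addr0.
have := is_derive_gap X 0 Us; rewrite /dgap scale0r addr0 => dg.
exact: (derive_ge0_right R _ _ e e0 dg (gap0 X) He).
Qed.

Lemma slope_lin a X Y : slope (a *: X + Y) = a * slope X + slope Y.
Proof.
have d1 := C2_on_diff R _ U H1 C2H1 _ Ux0.
have d2 := C2_on_diff R _ U H2 C2H2 _ Ux0.
rewrite /slope (derive_lin _ _ H1)// (derive_lin _ _ H2)//.
have lin (u1 v1 u2 v2 : R) :
  t * (a * u2 + v2) - (a * u1 + v1) = a * (t * u2 - u1) + (t * v2 - v1) by ring.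
exact: lin.
Qed.

(* The Robin condition makes the slope vanish along the conormal, hence along a
   direction leaving the cap. *)
Lemma outward_flat : exists mu : 'rV[R]_n.+1,
  [/\ dotv mu nu = 0, slope mu = 0 & 0 < x0 0 ord_max \/ mu 0 ord_max < 0].
Proof.
have [x0m _] := x0cap; move: x0m; rewrite le_eqVlt => /predU1P[x00|x0p].
  have bx0 : bcap n theta x0 by split.
  exists (conormal n theta x0); split.
  - exact: conormal_tangent.
  - by rewrite /slope robin1// robin2// eq12; ring.
  - by right; rewrite conormal_last// oppr_lt0 sin_gt0_pi.
exists 0; split; last by left.
- by rewrite -[X in dotv X](scale0r (0 : 'rV[R]_n.+1)) dotvZl mul0r.
- by rewrite /slope !derive0 mulr0 subrr.
Qed.

(** Adding a multiple of [mu] turns any tangent vector into an inward one without changing its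
    slope. So the slope is nonnegative on the tangent space, and being linear it is zero. *)
Lemma slope_tangent X : dotv X nu = 0 -> slope X = 0.
Proof.
have [mu [munu mu0 amu]] := outward_flat.
have ge0 Y : dotv Y nu = 0 -> 0 <= slope Y.
  move=> Ynu.
  have [M inM] : exists M, inward (M *: mu + Y).
    case: amu => [a0|mum].
      by exists 0; split; [rewrite scale0r add0r | left].
    (* As [mu] points down, this coefficient changes the last coordinate of [Y] to
       [Y + |Y| + 1 > 0]. *)
    exists ((`|Y 0 ord_max| + 1) / mu 0 ord_max); split.
      by rewrite dotvDl dotvZl munu Ynu mulr0 addr0.
    right; rewrite !mxE divfK ?lt_eqF//.
    have := ler_norm (- Y 0 ord_max); rewrite normrN.
    by move: (Y 0 ord_max) `|_| => y z yz; lra.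
  by have := slope_ge0 _ inM; rewrite slope_lin mu0 mulr0 add0r.
move=> Xnu; apply/eqP; rewrite eq_le ge0// andbT.
have := ge0 (- X); rewrite dotvNl Xnu oppr0 => /(_ erefl).
rewrite -[- X]addr0 -scaleN1r slope_lin.
have -> : slope 0 = 0 by rewrite /slope !derive0 mulr0 subrr.
by rewrite addr0 mulN1r oppr_ge0.
Qed.

(** The slope vanishes, so the one-sided second derivative test applies to the gap. *)
Lemma curv_inward X : inward X -> 0 <= curv X.
Proof.
move=> inX; have [e e0 He] := gap_ge0 X inX.
have [e' e'0 He'] := open_ray R _ U x0 X oU Ux0.
apply: (derive2_ge0_right R (gap X) (dgap X) _ (Num.min e e')).
- by rewrite lt_min e0.
- move=> s /andP[s0]; rewrite lt_min => /andP[_ se'].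
  by apply: is_derive_gap; apply: He'; rewrite s0.
- exact: is_derive_dgap.
- exact: gap0.
- by have := slope_tangent X inX.1; rewrite /slope /dgap scale0r addr0.
- by move=> s /andP[s0]; rewrite lt_min => /andP[se _]; apply: He; rewrite s0.
Qed.

Lemma curv_lin a X Y : curv (a *: X + Y) =
  a ^+ 2 * curv X + 2 * a * (t * hess H2 x0 X Y - hess H1 x0 X Y) + curv Y.
Proof.
rewrite /curv !(hess_linl R _ U _ C2H1)// !(hess_linl R _ U _ C2H2)//.
rewrite !(hess_linr R _ U _ oU C2H1)// !(hess_linr R _ U _ oU C2H2)//.
rewrite (hess_sym R _ U _ oU C2H1 x0 Y X)// (hess_sym R _ U _ oU C2H2 x0 Y X)//.
move: (hess _ _ X X) (hess _ _ X Y) (hess _ _ Y Y).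
move: (hess _ _ X X) (hess _ _ X Y) (hess _ _ Y Y) => *; ring.
Qed.

(** [curv] is even, so at a boundary point either sign of [X] may be taken. Vectors tangent to the
    boundary are limits of the inward vectors [X - e mu]. *)
Lemma curv_tangent X : dotv X nu = 0 -> 0 <= curv X.
Proof.
move=> Xnu; have [mu [munu _ amu]] := outward_flat.
have curvN Y : curv (- Y) = curv Y.
  (* Evenness is read off [curv_lin] with coefficient -2, since [4 - 4 + 1 = 1]. *)
  have -> : - Y = (- 2) *: Y + Y.
    rewrite -[X in _ + X]scale1r -scalerDl -scaleN1r; congr (_ *: _).
    by ring.
  have id4 (k : R) : (- 2) ^+ 2 * k + 2 * (- 2) * k + k = k by ring.
  by rewrite curv_lin; exact: id4.
have [a0|a0] := ltP 0 (x0 0 ord_max); first by apply: curv_inward; split; [|left].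
have {amu} mum : mu 0 ord_max < 0 by case: amu => //; rewrite ltNge a0.
have [X0|X0|X0] := ltgtP 0 (X 0 ord_max).
- by apply: curv_inward; split; [|right].
- rewrite -curvN; apply: curv_inward; split; first by rewrite dotvNl Xnu oppr0.
  by right; rewrite mxE oppr_gt0.
apply: (quad_ge0_limit R (curv mu)
  (- 2 * (t * hess H2 x0 mu X - hess H1 x0 mu X))) => e e0.
have sgn (k1 k2 k3 : R) : e ^+ 2 * k1 + e * (- 2 * k2) + k3 =
  (- e) ^+ 2 * k1 + 2 * - e * k2 + k3 by ring.
rewrite sgn -curv_lin; apply: curv_inward; split.
  by rewrite dotvDl dotvZl munu Xnu mulr0 addr0.
by right; rewrite !mxE -X0 addr0 nmulr_rgt0// oppr_lt0.
Qed.

End Touching.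

(** * Comparison of two solutions at a maximum of their quotient *)

Lemma C2_cap_common (R : realType) n theta (h1 h2 : 'rV[R]_n.+1 -> R) :
  C2_cap n theta h1 -> C2_cap n theta h2 ->
  exists U, [/\ open U, cap n theta `<=` U,
    C2_on U (hext n theta h1) & C2_on U (hext n theta h2)].
Proof.
move=> [U1 [oU1 [cU1 C1]]] [U2 [oU2 [cU2 C2]]]; exists (U1 `&` U2); split.
- exact: openI.
- by move=> x cx; split; [exact: cU1 | exact: cU2].
- by move=> vs x [Ux _]; exact: C1.
- by move=> vs x [_ Ux]; exact: C2.
Qed.

(** Regularity is known for the homogeneous extensions, so the extreme value theorem is applied to
    their quotient, which agrees with [h1 / h2] on the cap. *)
Lemma ratio_max (R : realType) n theta (h1 h2 : 'rV[R]_n.+1 -> R) :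
  C2_cap n theta h1 -> C2_cap n theta h2 ->
  (forall xi, cap n theta xi -> 0 < h2 xi) ->
  cap n theta !=set0 ->
  exists2 x0, cap n theta x0 &
    forall xi, cap n theta xi -> h1 xi <= h1 x0 / h2 x0 * h2 xi.
Proof.
move=> C1 C2 h20 cap0.
have [U [oU cU C1U C2U]] := C2_cap_common R n theta h1 h2 C1 C2.
have [|x0 x0c Hx0] := @EVT_max_rV R _
    (fun x => hext n theta h1 x * (hext n theta h2 x)^-1) _ cap0
    (cap_compact R n theta).
  apply: continuous_in_subspaceT => x; rewrite inE => xc.
  have d1 := differentiable_continuous (C2_on_diff R _ U _ C1U x (cU _ xc)).
  have d2 := differentiable_continuous (C2_on_diff R _ U _ C2U x (cU _ xc)).
  apply: continuousM; first exact: d1.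
  by apply: continuousV; [rewrite hext_cap// gt_eqF// h20 | exact: d2].
rewrite inE in x0c; exists x0 => // xi xic.
have := Hx0 xi; rewrite inE => /(_ xic); rewrite !hext_cap//.
by rewrite ler_pdivrMr// h20.
Qed.

Section Comparison.
Variables (R : realType) (n k l : nat) (theta p : R) (f : 'rV[R]_n.+1 -> R).
Hypotheses (lk : (l < k)%N) (kn : (k <= n)%N) (theta_lt : 0 < theta < pi).
Hypothesis p_lt : (k - l + 1)%:R < p.
Hypothesis f_gt0 : forall xi, cap n theta xi -> 0 < f xi.

Lemma Wmat_hess h xi b :
  Wmat n theta h xi b = \matrix_(i, j) hess (hext n theta h) xi (row i b) (row j b).
Proof. by []. Qed.

Lemma Wmat_sym h (U : set 'rV[R]_n.+1) xi b :
  open U -> U xi -> C2_on U (hext n theta h) ->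
  (Wmat n theta h xi b)^T = Wmat n theta h xi b.
Proof.
move=> oU Ux C2h; rewrite Wmat_hess; apply/matrixP => i j; rewrite !mxE.
exact: (hess_sym R _ U _ oU C2h).
Qed.

Lemma comparison h1 h2 :
  is_solution n k l theta p f h1 -> is_solution n k l theta p f h2 ->
  forall xi, cap n theta xi -> h1 xi <= h2 xi.
Proof.
move=> [C1 h10 adm1 eq1 rob1] [C2 h20 adm2 eq2 rob2] xi xic.
have [|x0 x0c Hx0] := ratio_max R n theta h1 h2 C1 C2 h20; first by exists xi.
have [U [oU cU C1U C2U]] := C2_cap_common R n theta h1 h2 C1 C2.
have [b fb] := tframe_exists R n theta theta_lt x0 x0c.
have t0 : 0 < h1 x0 / h2 x0 by rewrite divr_gt0 ?h10 ?h20.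
have ht : h1 x0 = h1 x0 / h2 x0 * h2 x0 by rewrite divfK// gt_eqF// h20.
set t := h1 x0 / h2 x0 in Hx0 t0 ht; clearbody t.
suff t1 : t <= 1.
  by apply: le_trans (Hx0 _ xic) _; rewrite ler_piMl// ltW// h20.
pose A := Wmat n theta h1 x0 b; pose B := Wmat n theta h2 x0 b.
have symA : A^T = A by exact: Wmat_sym (cU _ x0c) C1U.
have symB : B^T = B by exact: Wmat_sym (cU _ x0c) C2U.
have quadP (y : 'rV[R]_n) : 0 <= t * (y *m B *m y^T) 0 0 - (y *m A *m y^T) 0 0.
  have tan : dotv (y *m b) (x0 - ccenter n theta) = 0.
    by apply: dotv_mulmxl => i; exact: fb.2.
  have := curv_tangent R n theta t h1 h2 U x0 theta_lt oU cU C1U C2U x0c Hx0 ht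
    (rob1 x0) (rob2 x0) _ tan.
  rewrite (hess_mulmx R _ U _ oU C1U)//; last exact: cU.
  by rewrite (hess_mulmx R _ U _ oU C2U)//; exact: cU.
have GA i : (i <= k)%N -> 0 < sigmaj i A.
  case: i => [|i] ik; first by rewrite sigmaj0.
  by apply: (adm1 x0 b x0c fb); rewrite ik.
have eqA : sigmaj k A / sigmaj l A = f x0 * h1 x0 `^ (p - 1) by exact: eq1.
have eqB : sigmaj k B / sigmaj l B = f x0 * h2 x0 `^ (p - 1) by exact: eq2.
clearbody A B.
have symP : (t *: B - A)^T = t *: B - A by rewrite linearB linearZ/= symA symB.
have psdP : psd (t *: B - A).
  move=> y; have := quadP y.
  by rewrite mulmxBr mulmxBl -scalemxAr -scalemxAl !mxE.
(* Since [t B = A + (t B - A)], monotonicity compares the quotient at [A] with the one at [t B],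
   which is [t^(k-l)] times the one at [B]. *)
have [_ /(_ l (ltnW lk))] := sigmaj_psd R n k A (t *: B - A) kn symA symP psdP GA.
have ln : (l <= n)%N by rewrite (leq_trans (ltnW lk)).
rewrite [A + _]addrC subrK !sigmajZ ?gt_eqF//.
have t_ge0 := ltW t0; have h2_ge0 := ltW (h20 _ x0c).
rewrite eqA -mulf_div eqB ht powRM//.
have -> : t ^+ k / t ^+ l = t ^+ (k - l).
  by rewrite -{1}(subnK (ltnW lk)) exprD mulfK// expf_neq0// gt_eqF.
(* Cancelling [f h2^(p-1)] leaves [t^(p-1) <= t^(k-l)], to be compared through logarithms. *)
rewrite mulrCA ler_pM2r; last by rewrite mulr_gt0 ?f_gt0 ?powR_gt0 ?h20.
rewrite -powR_mulrn// /powR gt_eqF// ler_expR => le.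
rewrite leNgt; apply/negP => t1; have lt0 := ln_gt0 t1.
move: le; rewrite ler_pM2r// leNgt => /negP; apply.
by move: p_lt; rewrite natrD; lra.
Qed.

End Comparison.

Theorem theorem5p1 (R : realType) (n k l : nat) (theta p : R)
    (f : 'rV[R]_(n.+1) -> R) :
  (2 <= n)%N -> (l < k)%N -> (k <= n)%N ->
  0 < theta < pi ->
  (k - l + 1)%:R < p ->
  smooth_cap n theta f ->
  (forall xi, cap n theta xi -> 0 < f xi) ->
  forall h1 h2 : 'rV[R]_(n.+1) -> R,
    is_solution n k l theta p f h1 -> is_solution n k l theta p f h2 ->
    forall xi, cap n theta xi -> h1 xi = h2 xi.
Proof.
move=> _ lk kn theta_lt p_lt _ f_gt0 h1 h2 sol1 sol2 xi xic.
have cmp := comparison R n k l theta p f lk kn theta_lt p_lt f_gt0.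
by apply/eqP; rewrite eq_le !cmp.
Qed.
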